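(* In the setting described in the context, for all partitions $\lambda^{(1)},\dots,\lambda^{(N)}$, $$ \mathrm{Prob}\big(\lambda(v_i)=\lambda^{(i)}\ \text{for } 1\le i\le N\big)=\frac1Z\, s_{\lambda^{(1)}}(X^-_1)\,\prod_{i=1}^{N-1}\Big(\sum_{\nu} s_{\lambda^{(i)}/\nu}(X^+_i)\, s_{\lambda^{(i+1)}/\nu}(X^-_{i+1})\Big)\, s_{\lambda^{(N)}}(X^+_N), $$ where the sum is over all partitions $\nu$, $X^-_i=(x^-_m)_{m\in\mathbb Z+\frac12,\ u_{i-1}<m<v_i}$ and $X^+_i=(x^+_m)_{m\in\mathbb Z+\frac12,\ v_i<m<u_i}$. That is, the joint law of $(\lambda(v_1),\dots,\lambda(v_N))$ is a Schur process whose parameters are the polynomial specializations $X^\pm_i$.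
   Context: Fix an integer $N\ge1$ and integers $u_0<v_1<u_1<v_2<\dots<u_{N-1}<v_N<u_N$. For each integer $t$ with $u_0<t<u_N$ fix $q_t\in(0,1)$. For a half-integer $m\in(\mathbb Z+\frac12)\cap(u_0,u_N)$ write $m\in D^+$ if $v_i<m<u_i$ for some $1\le i\le N$, and $m\in D^-$ if $u_{i-1}<m<v_i$ for some $1\le i\le N$. For partitions, $\lambda\succ\mu$ (equivalently $\mu\prec\lambda$) means $\lambda_1\ge\mu_1\ge\lambda_2\ge\mu_2\ge\cdots$. A configuration is a sequence of partitions $(\lambda(t))_{t\in\mathbb Z}$ such that: - $\lambda(t)=\emptyset$ for $t\le u_0$ and for $t\ge u_N$; - for every half-integer $m\in(u_0,u_N)$: if $m\in D^-$ then $\lambda(m-\frac12)\prec\lambda(m+\frac12)$, and if $m\in D^+$ then $\lambda(m-\frac12)\succ\lambda(m+\frac12)$. These are exactly the sequences of diagonal slices of skew plane partitions with given inner shape (corners at the $v_i,u_i$) inside a box. The weight of a configuration is $W=\prod_{u_0<t<u_N} q_t^{|\lambda(t)|}$, where $|\lambda|=\sum_i\lambda_i$. The partition function is $Z=\sum W$ over all configurations, and the probability of a configuration is $W/Z$. Put $x^+_m=\prod_{t\in\mathbb Z,\,u_0<t<m}q_t$ and $x^-_m=(x^+_m)^{-1}$ for half-integers $m$. Here $s_{\lambda/\mu}(x_1,\dots,x_n)$ is the skew Schur polynomial, which is zero unless $\mu\subset\lambda$, and $s_\lambda=s_{\lambda/\emptyset}$. *)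

(* Defs.v *)
From HB Require Import structures.
From mathcomp Require Import all_boot all_order all_algebra.
From mathcomp Require Import all_classical all_reals.
From mathcomp Require Import topology normedtype sequences esum.
Set Implicit Arguments. Unset Strict Implicit. Unset Printing Implicit Defensive.
Import Order.TTheory GRing.Theory Num.Theory.
Local Open Scope ring_scope.

Definition is_partition (l : seq nat) : bool :=
  sorted geq l && all (fun k => (0 < k)%N) l.

Definition part (l : seq nat) (i : nat) : nat := nth 0%N l i.

Definition psize (l : seq nat) : nat := sumn l.

Definition interlace (mu lam : seq nat) : Prop :=
  forall i : nat, (part lam i.+1 <= part mu i <= part lam i)%N.

Definition psubset (mu lam : seq nat) : bool :=
  all (fun i => part mu i <= part lam i)%N (iota 0 (size mu)).

(* cells (row i, column j) of the skew diagram lam/mu, assuming mu ⊆ lam *)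
Definition skew_cells (mu lam : seq nat) : seq (nat * nat) :=
  flatten [seq [seq (i, j) | j <- iota (part mu i) (part lam i - part mu i)]
          | i <- iota 0 (size lam)].

Definition is_ssyt (mu lam : seq nat) (n : nat)
    (T : {ffun 'I_(size (skew_cells mu lam)) -> 'I_n}) : bool :=
  [forall a : 'I_(size (skew_cells mu lam)), forall b : 'I_(size (skew_cells mu lam)),
     let ca := nth (0, 0)%N (skew_cells mu lam) a in
     let cb := nth (0, 0)%N (skew_cells mu lam) b in
     ((cb == (ca.1, ca.2.+1)) ==> (T a <= T b)%N) &&
     ((cb == (ca.1.+1, ca.2)) ==> (T a < T b)%N)].

Definition skew_schur {R : comRingType} (x : seq R) (mu lam : seq nat) : R :=
  if psubset mu lam then
    \sum_(T : {ffun 'I_(size (skew_cells mu lam)) -> 'I_(size x)}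
            | is_ssyt T)
      \prod_(k : 'I_(size (skew_cells mu lam))) x`_(T k)
  else 0.

Definition irange (a b : int) : seq int :=
  if (a <= b) then [seq a + (k%:Z) | k <- iota 0 `|b - a|%N] else [::].

Section Model.
Variables (R : realType) (N : nat) (u v : nat -> int) (q : int -> R).

(* A half-integer m = t + 1/2 (t : int) is encoded by t = m - 1/2. *)
Definition inDminus (t : int) : Prop :=
  exists i : nat, [/\ (1 <= i <= N)%N, u i.-1 <= t & t < v i].
Definition inDplus (t : int) : Prop :=
  exists i : nat, [/\ (1 <= i <= N)%N, v i <= t & t < u i].

Definition is_config (f : int -> seq nat) : Prop :=
  [/\ forall t, is_partition (f t),
      forall t, t <= u 0%N \/ u N <= t -> f t = [::],
      forall t, u 0%N <= t < u N -> inDminus t -> interlace (f t) (f (t + 1)) &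
      forall t, u 0%N <= t < u N -> inDplus t -> interlace (f (t + 1)) (f t)].

Definition weight (f : int -> seq nat) : R :=
  \prod_(t <- irange (u 0%N + 1) (u N)) q t ^+ psize (f t).

Definition Zpart : \bar R :=
  esum [set f | is_config f] (fun f => (weight f)%:E).

Definition Prob (P : (int -> seq nat) -> Prop) : R :=
  fine (esum [set f | is_config f /\ P f] (fun f => (weight f)%:E)) / fine Zpart.

Definition xplus (t : int) : R := \prod_(s <- irange (u 0%N + 1) (t + 1)) q s.
Definition xminus (t : int) : R := (xplus t)^-1.

Definition Xminus (i : nat) : seq R := [seq xminus t | t <- irange (u i.-1) (v i)].
Definition Xplus (i : nat) : seq R := [seq xplus t | t <- irange (v i) (u i)].

Definition pair_sum (i : nat) (a b : seq nat) : R :=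
  fine (esum [set nu | is_partition nu]
    (fun nu => (skew_schur (Xplus i) nu a * skew_schur (Xminus i.+1) nu b)%:E)).

End Model.

(* Main.v *)
Require Import Defs.
From HB Require Import structures.
From mathcomp Require Import all_boot all_order all_algebra.
From mathcomp Require Import all_classical all_reals.
From mathcomp Require Import ereal topology normedtype sequences esum.
From mathcomp Require Import zify.
Import Order.TTheory GRing.Theory Num.Theory.
Local Open Scope ring_scope.
Set Implicit Arguments.
Unset Strict Implicit.
Unset Printing Implicit Defensive.

(** Since [q_t = x^+_t / x^+_(t-1)], summation by parts rewrites the weight of a
    configuration as a product over half-integers [m] of [x^-_m] or [x^+_m] to
    the size of the skew shape added or removed at [m].  Fixing the partitions
    at the [v_i], the total weight becomes a composition of one-variable
    kernels [up y a c = y^(|c|-|a|)] for [a < c] interlacing, and it factors at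
    the frozen times.  A run of such kernels is a skew Schur polynomial, because
    a semistandard tableau is the same as the interlacing chain of the shapes of
    its entries smaller than [k].  On the intervals [D^+] the variables come out
    in the reverse order, which is harmless because the kernels commute
    (Bender-Knuth involution).  All partitions that occur have bounded size, so
    the kernels are composed over a finite list [box B]. *)

(** * Partitions *)

Lemma part_default l i : (size l <= i)%N -> part l i = 0%N.
Proof. exact: nth_default. Qed.

Lemma part_nonincr l i j : is_partition l -> (i <= j)%N ->
  (part l j <= part l i)%N.
Proof.
move=> /andP[ls _] ij; case: (ltnP j (size l)) => jl; last by rewrite part_default.
have tr : transitive geq by move=> a b c /= ba ac; apply: leq_trans ac ba.
apply: (sorted_leq_nth tr _ 0%N ls) => //; first exact: leqnn.
by rewrite inE (leq_ltn_trans ij).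
Qed.

Lemma gt0_part l i : is_partition l -> (0 < part l i)%N = (i < size l)%N.
Proof.
move=> /andP[_ /allP l0]; case: (ltnP i (size l)) => il; last by rewrite part_default.
by apply: l0; apply: mem_nth.
Qed.

Lemma partition_ext l m : is_partition l -> is_partition m ->
  part l =1 part m -> l = m.
Proof.
move=> lp mp lm; have h i : (i < size l)%N = (i < size m)%N by rewrite -!gt0_part// lm.
have slm : size l = size m.
  apply/eqP; rewrite eqn_leq; apply/andP; split; rewrite leqNgt.
    by rewrite h ltnn.
  by rewrite -h ltnn.
by apply: (@eq_from_nth _ 0%N) => // i _; exact: lm.
Qed.

Lemma psizeE l n : (size l <= n)%N -> psize l = (\sum_(i < n) part l i)%N.
Proof.
rewrite /psize; elim: l n => [|k l IH] [|n]//= ln; rewrite ?big_ord0//.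
  by rewrite big1// => i _; rewrite part_default.
by rewrite big_ord_recl/= /part/=; congr addn; exact: IH.
Qed.

Lemma leq_psize l m : (forall i, (part l i <= part m i)%N) ->
  (psize l <= psize m)%N.
Proof.
move=> lm; rewrite (psizeE (leq_maxl (size l) (size m))).
by rewrite (psizeE (leq_maxr (size l) (size m))) leq_sum.
Qed.

Lemma part_le_psize l i : (part l i <= psize l)%N.
Proof.
case: (ltnP i (size l)) => il; last by rewrite part_default.
by rewrite (psizeE (leqnn _)) (bigD1 (Ordinal il))//= leq_addr.
Qed.

Lemma size_le_psize l : is_partition l -> (size l <= psize l)%N.
Proof.
move=> lp; rewrite (psizeE (leqnn _)).
rewrite -[X in (X <= _)%N]card_ord -sum1_card; apply: leq_sum => i _.
by rewrite gt0_part.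
Qed.

(** Zeros are dropped because the encoding of partitions lists positive parts only. *)
Definition mkpart (g : nat -> nat) (n : nat) : seq nat :=
  [seq k <- [seq g i | i <- iota 0 n] | 0 < k]%N.

(** For nonincreasing [g] the zero values come last, so filtering them out shifts no index. *)
Lemma part_mkpart g n i : (forall j, g j.+1 <= g j)%N ->
  part (mkpart g n) i = if (i < n)%N then g i else 0%N.
Proof.
elim: n g i => [|n IH] g i gS; first by rewrite /part nth_nil.
rewrite /mkpart/= -[1%N]/(1 + 0)%N iotaDl -map_comp.
have -> : [seq k <- [seq (g \o addn 1) i | i <- iota 0 n] | 0 < k]%N
  = mkpart (g \o S) n by [].
have IH' j := IH (g \o S) j (fun j => gS j.+1).
case: (ltnP 0 (g 0%N)) => g0; first by case: i => [|i]//; exact: IH'.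
have gz j : g j = 0%N.
  apply/eqP; rewrite -leqn0; elim: j => [//|j]; exact: leq_trans.
by rewrite IH' /= !gz !if_same.
Qed.

Lemma mkpart_is_partition g n : (forall j, g j.+1 <= g j)%N ->
  is_partition (mkpart g n).
Proof.
move=> gS; apply/andP; split; last exact: filter_all.
apply: sorted_filter; first by move=> a b c /= ba ac; apply: leq_trans ac ba.
apply: (homo_sorted (e := leq)) (iota_sorted _ _) => i j /= ij.
by elim: j ij => [|j IH]; rewrite leq_eqVlt => /predU1P[<-//|//] /IH; apply: leq_trans.
Qed.

Lemma mkpartK l n : is_partition l -> (size l <= n)%N -> mkpart (part l) n = l.
Proof.
move=> lp ln; have pS j : (part l j.+1 <= part l j)%N by exact: part_nonincr.
apply: partition_ext => //; first exact: mkpart_is_partition.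
move=> i; rewrite part_mkpart//; case: ltnP => // ni.
by rewrite part_default// (leq_trans ln).
Qed.

Lemma eq_mkpart g h n : (forall i, (i < n)%N -> g i = h i) ->
  mkpart g n = mkpart h n.
Proof.
move=> gh; rewrite /mkpart; have /eq_in_map -> // : {in iota 0 n, g =1 h}.
by move=> i; rewrite mem_iota/=; exact: gh.
Qed.

(** A partition of size at most [B] has at most [B] parts, each at most [B], so it is coded by a
    function from ['I_B] to ['I_B.+1]. The list is made duplicate-free since it serves as the index
    set of sums. *)
Definition box (B : nat) : seq (seq nat) :=
  [seq l <- undup [seq mkpart (fun i => oapp (fun j => f j : nat) 0%N (insub i)) B
                  | f : {ffun 'I_B -> 'I_B.+1} <- enum {ffun 'I_B -> 'I_B.+1}]
  | is_partition l && (psize l <= B)%N].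

Lemma box_uniq B : uniq (box B).
Proof. exact: filter_uniq (undup_uniq _). Qed.

Lemma mem_box B l : (l \in box B) = is_partition l && (psize l <= B)%N.
Proof.
rewrite mem_filter andb_idr// => /andP[lp lB]; rewrite mem_undup.
apply/mapP; exists [ffun i : 'I_B => inord (part l i)]; first by rewrite mem_enum.
rewrite -[LHS](@mkpartK _ B)//; last exact: leq_trans (size_le_psize lp) lB.
apply: eq_mkpart => i iB; rewrite (insubT (fun i => (i < B)%N) iB)/= ffunE inordK//.
by rewrite ltnS (leq_trans (part_le_psize _ _)).
Qed.

Lemma interlace_le mu lam : interlace mu lam ->
  forall i, (part mu i <= part lam i)%N.
Proof. by move=> ml i; have /andP[] := ml i. Qed.

Lemma interlace_psize mu lam : interlace mu lam -> (psize mu <= psize lam)%N.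
Proof. by move/interlace_le/leq_psize. Qed.

Lemma interlace_size mu lam : is_partition mu -> is_partition lam ->
  interlace mu lam -> (size mu <= size lam <= (size mu).+1)%N.
Proof.
move=> mp lp ml; apply/andP; split; rewrite leqNgt -gt0_part// -leqNgt.
  by rewrite (leq_trans (interlace_le ml _))// part_default.
have /andP[+ _] := ml (size mu); rewrite [part mu _]part_default//.
Qed.

(** * Composition of interlacing kernels *)

Lemma size_mkpart g n : (size (mkpart g n) <= n)%N.
Proof. by rewrite size_filter (leq_trans (count_size _ _))// size_map size_iota. Qed.

(** Reindexing tool for the two bijections of the proof: the Bender-Knuth involution and the passage
    from tableaux to chains of shapes. *)
Lemma big_seq_bij (V : nmodType) (I J : eqType) (s : seq I) (t : seq J)
    (h : I -> J) (F : J -> V) :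
  uniq s -> uniq t -> {in s &, injective h} ->
  (forall j, j \in t <-> exists2 i, i \in s & h i = j) ->
  \sum_(j <- t) F j = \sum_(i <- s) F (h i).
Proof.
move=> us ut hi ht; rewrite -(big_map h xpredT F); apply: perm_big.
apply: uniq_perm => //; first by rewrite map_inj_in_uniq.
move=> j; apply/idP/mapP => [/ht[i si <-]|[i si ->]]; first by exists i.
by apply/ht; exists i.
Qed.

(* The reflection [c i |-> lo i + hi i - c i] of each part of [c] in its range
   of admissible values swaps the two size increments of [a < c < b]; this is
   the Bender-Knuth involution. *)
Definition bk_hi (a b : seq nat) (i : nat) : nat :=
  if i is j.+1 then minn (part b i) (part a j) else part b 0.
Definition bk_lo (a b : seq nat) (i : nat) : nat :=
  maxn (part b i.+1) (part a i).
Definition bk_refl (a b c : seq nat) : seq nat :=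
  mkpart (fun i => bk_hi a b i + bk_lo a b i - part c i)%N (size b).+1.

Lemma bk_hiS a b i : bk_hi a b i.+1 = minn (part b i.+1) (part a i).
Proof. by []. Qed.

Section BenderKnuth.
Variables (a b : seq nat).
Hypotheses (ap : is_partition a) (bp : is_partition b).

Lemma bk_range c : interlace a c -> interlace c b ->
  forall i, (bk_lo a b i <= part c i <= bk_hi a b i)%N.
Proof.
move=> ac cb i; rewrite /bk_lo /bk_hi.
have /andP[a1 a2] := ac i; have /andP[c1 c2] := cb i.
case: i a1 a2 c1 c2 => [|i] a1 a2 c1 c2; first by rewrite geq_max c1 a2 c2.
by have /andP[a3 a4] := ac i; rewrite geq_max c1 a2 leq_min c2 a3.
Qed.

(** Both interlacings amount to separate interval conditions on the parts of [c]. This independence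
    is what allows each part to be reflected in its own interval. *)
Lemma bk_interlace c :
  (forall i, (bk_lo a b i <= part c i <= bk_hi a b i)%N) ->
  interlace a c /\ interlace c b.
Proof.
move=> h; split=> i; have := h i; have := h i.+1; rewrite /bk_lo /bk_hi;
  rewrite !geq_max !leq_min => /andP[/andP[x1 x2] /andP[x3 x4]] /andP[/andP[y1 y2]].
  by rewrite x4 y2.
by rewrite y1; case: i {x1 x2 x3 x4 y1 y2} => [//|i]; rewrite leq_min => /andP[].
Qed.

(** The reflected parts are nonincreasing because each lies in its interval and
    [bk_hi a b i.+1 <= bk_lo a b i], a minimum against the maximum of the same two numbers. *)
Lemma part_bk_refl c : interlace a c -> interlace c b ->
  forall i, part (bk_refl a b c) i = (bk_hi a b i + bk_lo a b i - part c i)%N.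
Proof.
move=> ac cb i; rewrite /bk_refl part_mkpart; last first.
  move=> j; have := bk_range ac cb j; have := bk_range ac cb j.+1.
  rewrite bk_hiS /bk_lo; lia.
(* Beyond the cut-off of [mkpart] both bounds and the part of [c] vanish. *)
case: ltnP => //; case: i => [//|i] bi.
have b1 : part b i.+1 = 0%N by rewrite part_default// ltnW.
have b2 : part b i.+2 = 0%N by rewrite part_default// ltnW// ltnW.
have := interlace_le ac i.+1; have := interlace_le cb i.+1.
rewrite /bk_lo bk_hiS; lia.
Qed.

(** The size identity comes from pairing the upper bound at [i.+1] with the lower bound at [i]: a
    minimum plus a maximum is [part b i.+1 + part a i]. The unpaired end terms are [part b 0] and
    [part a n]. *)
Lemma bk_refl_spec c : is_partition c -> interlace a c -> interlace c b ->
  [/\ is_partition (bk_refl a b c), interlace a (bk_refl a b c),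
      interlace (bk_refl a b c) b &
      (psize (bk_refl a b c) + psize c = psize a + psize b)%N].
Proof.
move=> cp ac cb; have pE := part_bk_refl ac cb; have cr := bk_range ac cb.
have [|ad db] := @bk_interlace (bk_refl a b c).
  by move=> i; rewrite pE; have := cr i; lia.
split=> //.
  apply: mkpart_is_partition => j; have := cr j; have := cr j.+1.
  rewrite bk_hiS /bk_lo; lia.
set n := size b.
have size_le l : is_partition l -> (forall i, (part l i <= part b i)%N) ->
    (size l <= n)%N.
  move=> lp lb; rewrite leqNgt -gt0_part// -leqNgt.
  by rewrite (leq_trans (lb _))// part_default.
have ab i : (part a i <= part b i)%N.
  exact: leq_trans (interlace_le ac i) (interlace_le cb i).
rewrite (@psizeE _ n.+1) ?size_mkpart// (@psizeE c n.+1); last first.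
  by rewrite leqW// size_le//; exact: interlace_le.
have bE : psize b = (part b 0 + \sum_(i < n) part b i.+1)%N.
  by rewrite (@psizeE b n.+1) ?leqnSn// big_ord_recl.
have aE : psize a = (\sum_(i < n) part a i + part a n)%N.
  by rewrite (@psizeE a n.+1) ?leqW ?size_le// big_ord_recr.
have hiE : (\sum_(i < n.+1) bk_hi a b i =
    part b 0 + \sum_(i < n) minn (part b i.+1) (part a i))%N.
  by rewrite big_ord_recl; congr addn; apply: eq_bigr => i _; rewrite lift0.
have loE : (\sum_(i < n.+1) bk_lo a b i =
    \sum_(i < n) maxn (part b i.+1) (part a i) + part a n)%N.
  by rewrite big_ord_recr/= /bk_lo (@part_default b n.+1)// max0n.
have minmaxE : (\sum_(i < n) minn (part b i.+1) (part a i) +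
    \sum_(i < n) maxn (part b i.+1) (part a i) =
    \sum_(i < n) part b i.+1 + \sum_(i < n) part a i)%N.
  by rewrite -!big_split/=; apply: eq_bigr => i _; lia.
rewrite -big_split/= (eq_bigr (fun i : 'I_n.+1 => bk_hi a b i + bk_lo a b i)%N).
  by rewrite big_split/= hiE loE bE aE; lia.
move=> i _; rewrite pE; have := cr i; lia.
Qed.

Lemma bk_reflK c : is_partition c -> interlace a c -> interlace c b ->
  bk_refl a b (bk_refl a b c) = c.
Proof.
move=> cp ac cb; have [dp ad db _] := bk_refl_spec cp ac cb.
have [ep _ _ _] := bk_refl_spec dp ad db.
apply: partition_ext => // i; rewrite !part_bk_refl//.
have := bk_range ac cb i; lia.
Qed.

End BenderKnuth.

(** * Matrix products of kernels over bounded partitions *)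

Section Chains.
Variables (R : comNzRingType) (B : nat).
Implicit Types (K : seq nat -> seq nat -> R) (a b c : seq nat).

(** The closing identity matrix makes the last summation variable equal to [b], so a nonempty chain
    is zero unless [b] lies in [box B]. *)
Fixpoint chain (Ks : seq (seq nat -> seq nat -> R)) a b : R :=
  if Ks is K :: Ks' then \sum_(c <- box B) K a c * chain Ks' c b
  else (a == b)%:R.

(** This is the one-variable skew Schur polynomial of [c/a]: interlacing says that [c/a] is a
    horizontal strip. *)
Definition up (y : R) a c : R :=
  if `[< interlace a c >] then y ^+ (psize c - psize a) else 0.

Lemma sum_box_delta a (F : seq nat -> R) : a \in box B ->
  \sum_(c <- box B) (a == c)%:R * F c = F a.
Proof.
move=> aB; rewrite (bigD1_seq a)//= ?box_uniq// eqxx mul1r big1 ?addr0// => c.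
by rewrite eq_sym => /negPf->; rewrite mul0r.
Qed.

Lemma chain1 K a b : b \in box B -> chain [:: K] a b = K a b.
Proof.
move=> bB /=; under eq_bigr do rewrite eq_sym mulrC.
exact: sum_box_delta.
Qed.

Lemma chain_cat Ks1 Ks2 a b : a \in box B ->
  chain (Ks1 ++ Ks2) a b =
  \sum_(c <- box B) chain Ks1 a c * chain Ks2 c b.
Proof.
elim: Ks1 a => [|K Ks1 IH] a aB /=; first by rewrite sum_box_delta.
under [RHS]eq_bigr do rewrite big_distrl/=.
rewrite exchange_big/=; apply: eq_big_seq => c cB.
by rewrite IH// big_distrr/=; apply: eq_bigr => d _; rewrite mulrA.
Qed.

(** Transposing a matrix product reverses the order of its factors. *)
Lemma chain_flip Ks a b : a \in box B -> b \in box B ->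
  chain [seq (fun x y => K y x) | K <- Ks] a b = chain (rev Ks) b a.
Proof.
elim: Ks a => [|K Ks IH] a aB bB /=; first by rewrite eq_sym.
rewrite rev_cons -cats1 chain_cat//; apply: eq_big_seq => c cB.
by rewrite IH// chain1// mulrC.
Qed.

Lemma up_comm y z a b : is_partition a -> b \in box B ->
  \sum_(c <- box B) up y a c * up z c b = \sum_(c <- box B) up z a c * up y c b.
Proof.
move=> ap; rewrite mem_box => /andP[bp bB].
pose P c := `[< interlace a c /\ interlace c b >].
have restrict y' z' : \sum_(c <- box B) up y' a c * up z' c b =
    \sum_(c <- [seq c <- box B | P c])
      y' ^+ (psize c - psize a) * z' ^+ (psize b - psize c).
  rewrite [RHS]big_filter [RHS]big_mkcond; apply: eq_bigr => c _; rewrite /up /P.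
  rewrite asbool_and; case: asboolP; rewrite ?mul0r// => _.
  by case: asboolP; rewrite ?mulr0.
(* The size bound of the box disappears here: [interlace c b] already gives
   [psize c <= psize b <= B]. *)
have PE c : (c \in [seq c <- box B | P c]) <->
    [/\ is_partition c, interlace a c & interlace c b].
  rewrite mem_filter mem_box; split=> [/and3P[/asboolP[? ?] ? _]//|[cp ac cb]].
  by rewrite cp (leq_trans (interlace_psize cb))// !andbT; apply/asboolP.
have us : uniq [seq c <- box B | P c] by rewrite filter_uniq// box_uniq.
(* The involution permutes the admissible [c] and exchanges the two size increments, hence the two
   exponents. *)
rewrite !restrict (@big_seq_bij _ _ _ _ _ (bk_refl a b) _ us us).
- apply: eq_big_seq => c /PE[cp ac cb].
  have [dp /interlace_psize ad /interlace_psize db E] := bk_refl_spec ap bp cp ac cb.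
  move: (interlace_psize ac) (interlace_psize cb) => lac lcb.
  rewrite mulrC; congr (_ ^+ _ * _ ^+ _); lia.
- by move=> c d /PE[? ? ?] /PE[? ? ?] /(congr1 (bk_refl a b)); rewrite !bk_reflK.
- move=> c; split=> [/PE[cp ac cb]|[d /PE[dp ad db] <-]]; last first.
    by apply/PE; have [] := bk_refl_spec ap bp dp ad db.
  exists (bk_refl a b c); last exact: bk_reflK.
  by apply/PE; have [] := bk_refl_spec ap bp cp ac cb.
Qed.

Lemma box_partition a : a \in box B -> is_partition a.
Proof. by rewrite mem_box => /andP[]. Qed.

Lemma chain_swap y z Ks a b : is_partition a ->
  chain (up y :: up z :: Ks) a b = chain (up z :: up y :: Ks) a b.
Proof.
move=> ap /=.
have E y' z' : \sum_(c <- box B) up y' a c *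
      (\sum_(d <- box B) up z' c d * chain Ks d b) =
    \sum_(d <- box B)
      (\sum_(c <- box B) up y' a c * up z' c d) * chain Ks d b.
  under eq_bigr do rewrite big_distrr/=.
  rewrite exchange_big/=; apply: eq_bigr => d _; rewrite big_distrl/=.
  by apply: eq_bigr => c _; rewrite mulrA.
rewrite !E; apply: eq_big_seq => d dB; congr (_ * _); exact: up_comm.
Qed.

(** Adjacent swaps carry the last kernel to the front. *)
Lemma chain_rcons x (s : seq R) a b : is_partition a ->
  chain (map up (rcons s x)) a b = chain (map up (x :: s)) a b.
Proof.
elim: s a => [//|y s IH] a ap.
rewrite rcons_cons [RHS]chain_swap//=; apply: eq_big_seq => c /box_partition cp.
by rewrite IH.
Qed.

Lemma chain_rev (s : seq R) a b : is_partition a ->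
  chain (map up (rev s)) a b = chain (map up s) a b.
Proof.
elim: s a => [//|x s IH] a ap; rewrite rev_cons chain_rcons//=.
by apply: eq_big_seq => c /box_partition cp; rewrite IH.
Qed.

(** Downward kernels are transposes of [up], so transposing the product reverses the variables;
    [chain_rev] then restores their order. *)
Lemma chain_down (s : seq R) a b : a \in box B -> b \in box B ->
  chain [seq (fun c d => up y d c) | y <- s] a b = chain (map up s) b a.
Proof.
move=> aB bB; rewrite -chain_rev ?box_partition// map_rev -chain_flip//.
by rewrite -map_comp.
Qed.

(** * Chains expanded into sums over paths *)

Fixpoint box_paths (n : nat) : seq (seq (seq nat)) :=
  if n is m.+1 then [seq c :: p | c <- box B, p <- box_paths m] else [:: [::]].

Lemma mem_box_paths n p :
  (p \in box_paths n) = (size p == n) && all (mem (box B)) p.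
Proof.
elim: n p => [|n IH] [|c p] //=.
  by apply/allpairsP => -[[? ?] []].
rewrite eqSS; apply/allpairsP/idP => [[[d q] [/= dB qn [-> ->]]]|].
  by rewrite IH in qn; move: qn dB => /andP[-> ->] ->.
by move=> /and3P[sp cB pB]; exists (c, p); split=> //=; rewrite IH sp.
Qed.

Lemma box_paths_uniq n : uniq (box_paths n).
Proof.
elim: n => [//|n IH] /=; apply: allpairs_uniq => //; first exact: box_uniq.
by move=> [c p] [d q] _ _ [-> ->].
Qed.

(** Distributivity. The path [p] omits its starting point, so step [k] goes from entry [k] of
    [a :: p] to entry [k] of [p]. *)
Lemma chain_path Ks a b :
  chain Ks a b = \sum_(p <- box_paths (size Ks) | last a p == b)
    \prod_(k < size Ks) nth (fun _ _ => 0) Ks k (nth [::] (a :: p) k) (nth [::] p k).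
Proof.
elim: Ks a => [|K Ks IH] a /=.
  by rewrite big_cons big_nil big_ord0/=; case: eqP => // _; rewrite addr0.
rewrite [RHS]big_mkcond big_allpairs_dep/=; apply: eq_big_seq => c cB.
rewrite -big_mkcond IH big_distrr/=; apply: eq_bigr => p _.
by rewrite big_ord_recl.
Qed.

End Chains.

(** * Tableaux as chains of partitions *)

Lemma psubsetP mu lam :
  reflect (forall i, (part mu i <= part lam i)%N) (psubset mu lam).
Proof.
apply: (iffP allP) => [h i|h i _]; last exact: h.
case: (ltnP i (size mu)) => im; last by rewrite part_default.
by apply: h; rewrite mem_iota.
Qed.

(** Every kernel [up] only enlarges shapes. This matches the convention that [skew_schur] is zero
    without containment. *)
Lemma chain_up_eq0 (R : comNzRingType) B (x : seq R) a b :
  ~~ psubset a b -> chain B (map (@up R) x) a b = 0.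
Proof.
elim: x a => [|y x IH] a ab /=.
  by case: eqP ab => // -> /negP[]; apply/psubsetP.
apply: big1 => c _; rewrite /up; case: asboolP => [ac|_]; last by rewrite mul0r.
rewrite IH ?mulr0//; apply: contra ab => /psubsetP cb; apply/psubsetP => i.
exact: leq_trans (interlace_le ac i) (cb i).
Qed.

(** A predicate closed under going down holds on an initial segment, whose length is the count. It
    is used both to read shapes off a tableau and to read entries off a path. *)
Lemma count_prefix (P : pred nat) m n :
  (forall j, m <= j -> j.+1 < m + n -> P j.+1 -> P j)%N ->
  forall j, (m <= j < m + n)%N -> P j = (j < m + count P (iota m n))%N.
Proof.
elim: n m => [|n IH] m Pd j mj /=; first by lia.
case: (boolP (P m)) => Pm.
  case: (eqVneq j m) => [->|jm]; first by rewrite Pm; lia.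
  rewrite (IH m.+1) ?addnA ?addn1//; last by lia.
  by move=> i im ij; apply: Pd; lia.
have nP i : (i <= n)%N -> ~~ P (m + i)%N.
  elim: i => [|i IHi] im; first by rewrite addn0.
  apply: contra (IHi (ltnW im)); rewrite addnS; apply: Pd; lia.
have -> : count P (iota m.+1 n) = 0%N.
  apply/eqP; rewrite -leqn0 leqNgt -has_count; apply/hasPn => i.
  rewrite mem_iota => im; have -> : i = (m + (i - m))%N by lia.
  by apply: nP; lia.
have [mj' jn] := andP mj; rewrite !addn0 ltnNge mj'/=; apply/negbTE.
by rewrite -(subnKC mj'); apply: nP; lia.
Qed.

Lemma leq_by_ltn m n : (forall j, j < m -> j < n)%N -> (m <= n)%N.
Proof. by case: m => [//|m]; apply. Qed.

(** * The shapes formed by the small entries of a tableau *)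

Section Tableaux.
Variables (a b : seq nat) (n : nat).
Hypotheses (ap : is_partition a) (bp : is_partition b).
Hypothesis ab : forall i, (part a i <= part b i)%N.

Local Notation cells := (skew_cells a b).
Local Notation tableau := {ffun 'I_(size cells) -> 'I_n}.

Lemma mem_skew_cells i j :
  ((i, j) \in cells) = (part a i <= j < part b i)%N.
Proof.
clear ap ab; apply/allpairsPdep/idP => [[k [l [_ + [-> ->]]]]|/andP[aj jb]].
  by rewrite mem_iota; lia.
exists i, j; split=> //; rewrite mem_iota; last by lia.
by rewrite -gt0_part//; lia.
Qed.

Lemma skew_cells_uniq : uniq cells.
Proof.
apply: allpairs_uniq_dep => [|i _|]; rewrite ?iota_uniq//.
by move=> [i j] [k l] _ _ /= [-> ->].
Qed.

(** Tableaux are indexed by positions in the list of cells; this reads them by coordinates, with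
    default 0 off the diagram. *)
Definition entry (T : tableau) (c : nat * nat) : nat :=
  oapp (fun k => T k : nat) 0%N (insub (index c cells)).

Lemma entry_nth T (k : 'I_(size cells)) : entry T (nth (0, 0)%N cells k) = T k.
Proof. by rewrite /entry index_uniq ?skew_cells_uniq// valK. Qed.

Lemma entry_lt T i j : (part a i <= j < part b i)%N -> (entry T (i, j) < n)%N.
Proof.
rewrite -mem_skew_cells => cij; rewrite -[X in entry T X](nth_index (0, 0)%N cij).
by have := cij; rewrite -index_mem => ic; rewrite (entry_nth T (Ordinal ic)).
Qed.

(** The bounds place both cells in the diagram: for a column pair, the monotonicity of [a] and [b]
    supplies the two missing inequalities. *)
Lemma is_ssytP T : reflect
  ((forall i j, part a i <= j -> j.+1 < part b i ->
      entry T (i, j) <= entry T (i, j.+1)) /\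
   (forall i j, part a i <= j -> j < part b i.+1 ->
      entry T (i, j) < entry T (i.+1, j)))%N
  (is_ssyt T).
Proof.
have ordE c : c \in cells -> exists2 k : 'I_(size cells),
    nth (0, 0)%N cells k = c & entry T c = T k.
  move=> cc; have := cc; rewrite -index_mem => ic.
  by exists (Ordinal ic) => /=; rewrite ?nth_index// -(entry_nth T (Ordinal ic))/= nth_index.
apply: (iffP forallP) => [h|[hr hc] k]; last first.
  apply/forallP => l /=; have := mem_nth (0, 0)%N (ltn_ord k).
  have := mem_nth (0, 0)%N (ltn_ord l); rewrite -!entry_nth.
  case: (nth _ _ k) => i j; case: (nth _ _ l) => i' j'.
  rewrite !mem_skew_cells/= => c' c.
  apply/andP; split; apply/implyP => /eqP[? ?]; subst i' j'.
    by apply: hr; lia.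
  by apply: hc; lia.
split=> i j aj jb.
  have [|k kE ->] := ordE (i, j); first by rewrite mem_skew_cells; lia.
  have [|l lE ->] := ordE (i, j.+1); first by rewrite mem_skew_cells; lia.
  by have /forallP/(_ l)/= := h k; rewrite kE lE eqxx /= => /andP[].
have aS := part_nonincr ap (leqnSn i); have bS := part_nonincr bp (leqnSn i).
have [|k kE ->] := ordE (i, j); first by rewrite mem_skew_cells; lia.
have [|l lE ->] := ordE (i.+1, j); first by rewrite mem_skew_cells; lia.
by have /forallP/(_ l)/= := h k; rewrite kE lE eqxx /= => /andP[].
Qed.

Definition row_len (T : tableau) (k i : nat) : nat :=
  (part a i + count (fun j => entry T (i, j) < k)
                    (iota (part a i) (part b i - part a i)))%N.

Definition ssyt_shape (T : tableau) (k : nat) : seq nat := mkpart (row_len T k) (size b).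

Section Ssyt.
Variable T : tableau.
Hypothesis Tss : is_ssyt T.

(** Rows increase weakly, so the entries smaller than [k] fill an initial segment of the row and
    their count determines which columns they occupy. *)
Lemma ltn_row_len k i j : (j < row_len T k i)%N =
  (j < part a i)%N || ((j < part b i)%N && (entry T (i, j) < k)%N).
Proof.
have [hr _] := is_ssytP _ Tss.
case: (ltnP j (part a i)) => /= ja; first by rewrite /row_len ltn_addr.
case: (ltnP j (part b i)) => /= jb.
  rewrite -count_prefix//; last by lia.
  move=> l al lb; apply: leq_ltn_trans; apply: hr => //; lia.
apply/negbTE; rewrite -leqNgt /row_len.
rewrite (leq_trans _ jb)// -[X in (_ <= X)%N](subnKC (ab i)) leq_add2l.
by rewrite (leq_trans (count_size _ _))// size_iota.
Qed.

(** The left inequality is column strictness: an entry at most [k] has an entry smaller than [k], or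
    a cell of [a], above it. The right one is monotonicity in the threshold. *)
Lemma row_lenS k i : (row_len T k.+1 i.+1 <= row_len T k i <= row_len T k.+1 i)%N.
Proof.
have [_ hc] := is_ssytP _ Tss.
have aS := part_nonincr ap (leqnSn i); have bS := part_nonincr bp (leqnSn i).
apply/andP; split; apply: leq_by_ltn => j; rewrite !ltn_row_len.
  case: (ltnP j (part a i)) => //= ja; rewrite ltnNge (leq_trans aS ja)/=.
  move=> /andP[jb jk]; rewrite (leq_trans jb bS)/=.
  by rewrite -ltnS; apply: leq_trans jk; rewrite ltnS; exact: hc.
by case: (_ < _)%N => //= /andP[-> ] /leqW.
Qed.

Lemma row_len_nonincr k i : (row_len T k i.+1 <= row_len T k i)%N.
Proof.
have /andP[h _] := row_lenS k i; have /andP[_ h'] := row_lenS k i.+1.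
exact: leq_trans h' h.
Qed.

Lemma part_shape k i : part (ssyt_shape T k) i = row_len T k i.
Proof.
rewrite part_mkpart; last exact: row_len_nonincr.
case: ltnP => // bi; rewrite /row_len part_default//.
  by rewrite (part_default bi) sub0n.
rewrite leqNgt -gt0_part// -leqNgt (leq_trans (ab i))//.
by rewrite part_default.
Qed.

Lemma shape_partition k : is_partition (ssyt_shape T k).
Proof. exact/mkpart_is_partition/row_len_nonincr. Qed.

Lemma shape_interlace k : interlace (ssyt_shape T k) (ssyt_shape T k.+1).
Proof. by move=> i; rewrite !part_shape row_lenS. Qed.

Lemma shape0 : ssyt_shape T 0 = a.
Proof.
apply: partition_ext => //; first exact: shape_partition.
by move=> i; rewrite part_shape /row_len count_pred0 addn0.
Qed.

Lemma shape_le k i : (part (ssyt_shape T k) i <= part b i)%N.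
Proof.
rewrite part_shape; apply: leq_by_ltn => j; rewrite ltn_row_len.
by case/orP => [/leq_trans->//|/andP[]].
Qed.

Lemma shapen : ssyt_shape T n = b.
Proof.
apply: partition_ext => //; first exact: shape_partition.
move=> i; apply/eqP; rewrite eqn_leq shape_le/= part_shape.
apply: leq_by_ltn => j jb; rewrite ltn_row_len jb/=.
by case: ltnP => //= ja; rewrite entry_lt// ja.
Qed.

Lemma psize_shape k :
  psize (ssyt_shape T k) = (psize a + count (fun c => entry T c < k) cells)%N.
Proof.
have sa : (size a <= size b)%N.
  rewrite leqNgt -gt0_part// -leqNgt (leq_trans (ab _))//.
  by rewrite part_default.
rewrite (@psizeE _ (size b)) ?size_mkpart// (psizeE sa).
under eq_bigr do rewrite part_shape.
rewrite big_split/=; congr addn; rewrite count_flatten sumnE !big_map.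
rewrite -[X in iota 0 X]subn0 -/(index_iota _ _) big_mkord.
by apply: eq_bigr => i _; rewrite count_map.
Qed.

(** Passing from threshold [k] to [k.+1] adds exactly the cells with entry [k], so this increment is
    the exponent of variable [k] in the monomial of [T]. *)
Lemma psize_shapeS k : (psize (ssyt_shape T k.+1) - psize (ssyt_shape T k))%N =
  #|[pred c : 'I_(size cells) | T c == k :> nat]|.
Proof.
rewrite !psize_shape subnDl.
have -> : count (fun c => entry T c < k.+1)%N cells =
    (count (fun c => entry T c < k)%N cells + count (fun c => entry T c == k) cells)%N.
  by elim: cells => //= c s ->; rewrite ltnS leq_eqVlt; case: ltngtP; lia.
rewrite addKn -sum1_count (big_nth (0, 0)%N) big_mkord -sum1_card.
by apply: eq_bigl => c; rewrite inE entry_nth.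
Qed.

End Ssyt.
End Tableaux.

(** * Bijection between semistandard tableaux and upward paths *)

Section SchurAsPaths.
Variables (a b : seq nat) (n : nat).
Hypotheses (ap : is_partition a) (bp : is_partition b).
Hypothesis ab : forall i, (part a i <= part b i)%N.

Local Notation cells := (skew_cells a b).
Local Notation tableau := {ffun 'I_(size cells) -> 'I_n}.

Definition shapes (T : tableau) : seq (seq nat) :=
  [seq ssyt_shape T k.+1 | k <- iota 0 n].

Definition up_path (p : seq (seq nat)) : Prop :=
  forall k, (k < n)%N -> interlace (nth [::] (a :: p) k) (nth [::] p k).

Lemma nth_shapes T k : (k < n)%N -> nth [::] (shapes T) k = ssyt_shape T k.+1.
Proof. by move=> kn; rewrite (nth_map 0%N) ?size_iota// nth_iota. Qed.

Lemma nth_cons_shapes T k : is_ssyt T -> (k <= n)%N ->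
  nth [::] (a :: shapes T) k = ssyt_shape T k.
Proof.
by move=> Ts; case: k => [_|k kn] /=; rewrite ?shape0// nth_shapes.
Qed.

Lemma shapes_up_path T : is_ssyt T -> up_path (shapes T).
Proof.
move=> Ts k kn; rewrite nth_cons_shapes ?nth_shapes// ?(ltnW kn)//.
exact: shape_interlace.
Qed.

Lemma last_shapes T : is_ssyt T -> last a (shapes T) = b.
Proof.
move=> Ts; have sz : size (shapes T) = n by rewrite size_map size_iota.
by rewrite (last_nth [::]) sz nth_cons_shapes// shapen.
Qed.

Lemma shapes_box B T : b \in box B -> is_ssyt T -> shapes T \in box_paths B n.
Proof.
move=> + Ts; rewrite mem_box_paths size_map size_iota eqxx/= mem_box => /andP[_ bB].
apply/allP => c /mapP[k _ ->]; rewrite [mem _ _]mem_box shape_partition//=.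
apply: leq_trans bB.
by apply: leq_psize => i; exact: shape_le.
Qed.

Lemma entry_ltE (T : tableau) k i j : is_ssyt T -> (part a i <= j < part b i)%N ->
  (entry T (i, j) < k)%N = (j < part (ssyt_shape T k) i)%N.
Proof.
move=> Ts /andP[aj jb]; rewrite part_shape// ltn_row_len// jb.
by rewrite [(j < part a i)%N]ltnNge aj.
Qed.

(** The shapes tell, for every threshold, whether an entry lies below it; taking the other tableau's
    entry as threshold gives both inequalities. *)
Lemma shapes_inj : {in [pred T : tableau | is_ssyt T] &, injective shapes}.
Proof.
move=> T T' Ts Ts' TT'; apply/ffunP => c; apply: val_inj => /=.
rewrite -!entry_nth//; have := mem_nth (0, 0)%N (ltn_ord c).
case: (nth _ _ c) => i j; rewrite mem_skew_cells// => cij.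
have E k : (k < n)%N -> (entry T (i, j) < k.+1)%N = (entry T' (i, j) < k.+1)%N.
  by move=> kn; rewrite !entry_ltE// -!nth_shapes// TT'.
apply/eqP; rewrite eqn_leq; apply/andP; split.
  by rewrite -ltnS E ?ltnSn// entry_lt.
by rewrite -ltnS -E ?ltnSn// entry_lt.
Qed.

Lemma up_path_shapes B p : p \in box_paths B n -> up_path p -> last a p = b ->
  exists2 T : tableau, is_ssyt T & shapes T = p.
Proof.
rewrite mem_box_paths => /andP[/eqP sp /allP pB] pv pb.
pose K k := nth [::] (a :: p) k.
have Kv k : (k < n)%N -> interlace (K k) (K k.+1) by exact: pv.
have Kp k : (k <= n)%N -> is_partition (K k).
  case: k => [//|k] kn; apply: (@box_partition B); apply: pB.
  by rewrite /K/= mem_nth// sp.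
have Kn : K n = b by rewrite /K -sp -last_nth.
have Kmono k l i : (k <= l <= n)%N -> (part (K k) i <= part (K l) i)%N.
  elim: l => [|l IH]; first by rewrite leqn0 => /andP[/eqP->].
  move=> /andP[]; rewrite leq_eqVlt => /predU1P[->//|kl ln].
  by rewrite (leq_trans (IH _))//; [rewrite -ltnS kl ltnW | exact/interlace_le/Kv].
(* The inverse map: the entry of a cell is the number of shapes among [K 1], ..., [K n] that do not
   yet contain it. *)
pose e i j := count (fun k => part (K k.+1) i <= j)%N (iota 0 n).
(* The shapes grow, so those missing the cell come first and [count_prefix] applies; [k = 0] holds
   because the cell is outside [a]. *)
have eE k i j : (part a i <= j < part b i)%N -> (k <= n)%N ->
    (e i j < k)%N = (j < part (K k) i)%N.
  move=> /andP[aj jb]; case: k => [_|k kn]; first by rewrite ltn0 ltnNge aj.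
  rewrite ltnS leqNgt [RHS]ltnNge; congr negb; rewrite /e.
  rewrite -(@count_prefix (fun k => part (K k.+1) i <= j)%N 0 n)//.
  by move=> l _ ln; apply: leq_trans; apply: Kmono; rewrite leqnSn.
have e_lt i j : (part a i <= j < part b i)%N -> (e i j < n)%N.
  by move=> c; rewrite eE// Kn; case/andP: c.
have cT (c : 'I_(size cells)) : (let x := nth (0, 0)%N cells c in e x.1 x.2 < n)%N.
  have := mem_nth (0, 0)%N (ltn_ord c); case: (nth _ _ c) => i j.
  by rewrite mem_skew_cells// => /e_lt.
pose T : tableau := [ffun c => Ordinal (cT c)].
have Te i j : (part a i <= j < part b i)%N -> entry T (i, j) = e i j.
  rewrite -(mem_skew_cells _ bp) => c; have := c; rewrite -index_mem => ic.
  by rewrite -(nth_index (0, 0)%N c) (entry_nth T (Ordinal ic)) ffunE/= nth_index.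
have Ts : is_ssyt T.
  apply/is_ssytP => //; split=> i j aj jb.
    rewrite !Te ?aj ?jb ?leqW ?(ltnW jb)// -ltnS.
    have c : (part a i <= j.+1 < part b i)%N by rewrite leqW.
    by rewrite eE ?e_lt// ?aj ?(ltnW jb)// ltnW// -eE ?e_lt.
  have aS := part_nonincr ap (leqnSn i); have bS := part_nonincr bp (leqnSn i).
  have c : (part a i.+1 <= j < part b i.+1)%N by rewrite (leq_trans aS).
  have c' : (part a i <= j < part b i)%N by rewrite aj (leq_trans jb).
  have el := e_lt _ _ c.
  rewrite !Te// eE ?(ltnW el)//.
  (* With [e] the entry of the lower cell, interlacing of [K e] and [K e.+1] puts the upper cell
     already in [K e], whence column strictness. *)
  have /andP[h _] := Kv _ el i; apply: leq_trans h.
  by rewrite -eE.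
exists T => //; apply: (@eq_from_nth _ [::]); rewrite size_map size_iota ?sp// => k kn.
rewrite nth_shapes// -[RHS]/(K k.+1); apply: partition_ext.
- exact: shape_partition.
- exact: Kp.
move=> i; rewrite part_shape//.
have lt j : (j < row_len T k.+1 i)%N = (j < part (K k.+1) i)%N.
  rewrite ltn_row_len//; have aK : (part a i <= part (K k.+1) i)%N.
    exact: (Kmono 0%N).
  have Kb : (part (K k.+1) i <= part b i)%N by rewrite -Kn Kmono// kn leqnn.
  case: (ltnP j (part a i)) => /= [/leq_trans->//|aj].
  case: (ltnP j (part b i)) => /= [jb|/(leq_trans Kb)].
    by rewrite Te ?aj// eE// aj.
  by rewrite leqNgt => /negbTE.
by apply/eqP; rewrite eqn_leq; apply/andP; split; apply: leq_by_ltn => j;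
  rewrite lt.
Qed.

End SchurAsPaths.

(** Only interlacing paths ending at [b] contribute to the path expansion of the chain, and these
    correspond to tableaux. *)
Lemma skew_schur_chain (R : comNzRingType) B (x : seq R) a b :
  is_partition a -> b \in box B ->
  skew_schur x a b = chain B (map (@up R) x) a b.
Proof.
move=> ap bB; have bp := box_partition bB.
rewrite /skew_schur; case: ifPn => [/psubsetP ab|]; last by move/chain_up_eq0->.
set n := size x; rewrite chain_path size_map -/n.
pose good p := `[< up_path a n p >] && (last a p == b).
have -> : \sum_(p <- box_paths B n | last a p == b)
    \prod_(k < n) nth (fun _ _ => 0) (map (@up R) x) k
      (nth [::] (a :: p) k) (nth [::] p k) =
  \sum_(p <- [seq p <- box_paths B n | good p])
    \prod_(k < n) x`_k ^+ (psize (nth [::] p k) - psize (nth [::] (a :: p) k)).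
  rewrite [RHS]big_filter [RHS]big_mkcond [LHS]big_mkcond; apply: eq_bigr => p _.
  rewrite /good andbC; case: eqP => //= _; case: asboolP => [pv|npv].
    apply: eq_bigr => k _; rewrite (nth_map 0)// /up.
    by rewrite asboolT//; exact: pv.
  have /existsNP[k /not_implyP[kn nk]] := npv; rewrite (bigD1 (Ordinal kn))//= (nth_map 0)//.
  by rewrite /up asboolF// mul0r.
rewrite -[LHS]big_filter; apply/esym.
rewrite (@big_seq_bij _ _ _ [seq T <- index_enum _ | is_ssyt T] _
  (@shapes a b n)).
- apply: eq_big_seq => T; rewrite mem_filter => /andP[Ts _].
  under eq_bigr => k _.
    rewrite nth_shapes// nth_cons_shapes// ?(ltnW (ltn_ord k))//.
    rewrite psize_shapeS//; over.
  (* Grouping the cells by entry turns the tableau monomial into a product of powers of the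
     variables. *)
  rewrite [RHS](partition_big T xpredT)//=; apply: eq_bigr => k _.
  rewrite (eq_bigr (fun=> x`_k)) => [|c /eqP->//].
  by rewrite prodr_const.
- exact/filter_uniq/index_enum_uniq.
- exact/filter_uniq/box_paths_uniq.
- move=> T T'; rewrite !mem_filter => /andP[? _] /andP[? _].
  exact: shapes_inj.
- move=> p; rewrite mem_filter /good; split=> [/andP[/andP[/asboolP pv /eqP pl] pB]|].
    have [T Ts <-] := up_path_shapes ap bp ab pB pv pl.
    by exists T => //; rewrite mem_filter Ts mem_index_enum.
  move=> [T]; rewrite mem_filter => /andP[Ts _] <-.
  rewrite shapes_box// last_shapes// eqxx andbT.
  by apply/andP; split=> //; apply/asboolP; exact: shapes_up_path.
Qed.

(** * Configurations *)

Lemma size_irange (a b : int) : a <= b -> size (irange a b) = `|b - a|%N.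
Proof. by move=> ab; rewrite /irange ab size_map size_iota. Qed.

Lemma nth_irange (a b : int) k : a <= b -> (k < `|b - a|)%N ->
  nth 0 (irange a b) k = a + k%:Z.
Proof.
by move=> ab kab; rewrite /irange ab (nth_map 0%N) ?size_iota// nth_iota.
Qed.

Lemma mem_irange (a b t : int) : (t \in irange a b) = (a <= t < b).
Proof.
rewrite /irange; case: ifPn => ab; last by apply/esym/negbTE; lia.
apply/mapP/idP => [[k]|atb]; first by rewrite mem_iota => ? ->; lia.
by exists `|t - a|%N; rewrite ?mem_iota; lia.
Qed.

Lemma irange_cat (a b c : int) : a <= b -> b <= c ->
  irange a c = irange a b ++ irange b c.
Proof.
move=> ab bc; have ac := le_trans ab bc; rewrite /irange ab bc ac.
have -> : `|c - a|%N = (`|b - a| + `|c - b|)%N by lia.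
rewrite iotaD map_cat add0n; congr cat.
rewrite -[X in iota X]addn0 iotaDl -map_comp; apply: eq_map => k /=; lia.
Qed.

Lemma irangeS (a b : int) : a <= b -> irange a (b + 1) = rcons (irange a b) b.
Proof.
move=> ab; rewrite (@irange_cat a b) -?cats1//; last by lia.
congr cat; rewrite /irange ifT; last by lia.
by rewrite addrAC subrr add0r /= addr0.
Qed.

Lemma irange_cons (a b : int) : a < b -> irange a b = a :: irange (a + 1) b.
Proof.
move=> ab; rewrite (@irange_cat a (a + 1)); try by lia.
by rewrite irangeS// /irange lexx subrr.
Qed.

Lemma eq_chain_map (R : comNzRingType) B (K K' : int -> seq nat -> seq nat -> R) s :
  {in s, forall t a c, K t a c = K' t a c} ->
  forall a b, chain B (map K s) a b = chain B (map K' s) a b.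
Proof.
elim: s => [//|t s IH] KK' a b /=; apply: eq_bigr => c _.
rewrite KK' ?mem_head//; congr (_ * _); apply: IH => r rs; apply: KK'.
by rewrite inE rs orbT.
Qed.

Lemma skew_schur_ge0 (R : realType) (x : seq R) a b :
  {in x, forall y, 0 <= y} -> 0 <= skew_schur x a b.
Proof.
move=> x0; rewrite /skew_schur; case: ifP => // _.
by apply: sumr_ge0 => T _; apply: prodr_ge0 => k _; apply: x0; rewrite mem_nth.
Qed.

(** Subtraction on [nat] truncates, so the sign of the exponent decides between [y] and its inverse,
    that is, between the variables of type plus and minus. *)
Lemma expf_div (F : fieldType) (y : F) m n : y != 0 ->
  y ^+ m / y ^+ n = if (m <= n)%N then y^-1 ^+ (n - m) else y ^+ (m - n).
Proof.
move=> y0; case: leqP => [mn|/ltnW nm].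
  by rewrite -[n in LHS](subnKC mn) exprD invfM mulrA divff ?mul1r ?exprVn// expf_neq0.
by rewrite -[m in LHS](subnK nm) exprD mulfK// expf_neq0.
Qed.

Lemma geometric_sum_le (R : realFieldType) (y : R) n : 0 < y < 1 ->
  \sum_(e < n) y ^+ e <= (1 - y)^-1.
Proof.
move=> /andP[y0 y1]; have d0 : 0 < 1 - y by rewrite subr_gt0.
rewrite -[leRHS]mul1r ler_pdivlMr// mulrC -opprB mulNr -subrX1 opprB.
by rewrite gerBl exprn_ge0// ltW.
Qed.

(** * Chains of steps as products of skew Schur polynomials *)

Section JointLaw.
Variables (R : realType) (N : nat) (u v : nat -> int) (q : int -> R).
Variable lam : nat -> seq nat.
Hypothesis uv : forall i : nat, (1 <= i <= N)%N -> u i.-1 < v i /\ v i < u i.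
Hypothesis q01 : forall t : int, u 0%N < t < u N -> 0 < q t < 1.
Hypothesis lamP : forall i : nat, (1 <= i <= N)%N -> is_partition (lam i).

Local Notation x := (xplus u q).

Lemma u_mono i j : (i <= j <= N)%N -> u i <= u j.
Proof.
elim: j => [|j IH] /andP[]; first by rewrite leqn0 => /eqP->.
rewrite leq_eqVlt => /predU1P[->//|ij jN].
apply: le_trans (IH _) _; first by rewrite -ltnS ij ltnW.
by have [|/= ? ?] := @uv j.+1; [rewrite jN | lia].
Qed.

Lemma u_locate n t : (n <= N)%N -> u 0%N <= t < u n ->
  exists2 i, (1 <= i <= n)%N & u i.-1 <= t < u i.
Proof.
elim: n => [|n IH] nN tn; first by lia.
case: (ltP t (u n)) => tun; last by exists n.+1; rewrite /= ?ltnSn ?tun//; case/andP: tn.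
have [|i iN ti] := IH (ltnW nN); first by rewrite tun andbT; case/andP: tn.
by exists i => //; lia.
Qed.

Lemma u_locate_uniq i j t : (1 <= i <= N)%N -> (1 <= j <= N)%N ->
  u i.-1 <= t < u i -> u j.-1 <= t < u j -> i = j.
Proof.
move=> iN jN ti tj; case: (ltngtP i j) => // ij.
  by have := @u_mono i j.-1; lia.
by have := @u_mono j i.-1; lia.
Qed.

Lemma v_bounds i : (1 <= i <= N)%N -> u 0%N < v i /\ v i < u N.
Proof.
move=> iN; have [h1 h2] := uv iN.
by have := @u_mono 0 i.-1; have := @u_mono i N; lia.
Qed.

Lemma xplusS t : u 0%N <= t -> x (t + 1) = x t * q (t + 1).
Proof.
move=> ut; rewrite /xplus (@irangeS _ (t + 1)); last by lia.
by rewrite -cats1 big_cat/= big_seq1.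
Qed.

Lemma xplus_gt0 t : t < u N -> 0 < x t.
Proof.
move=> tN; rewrite /xplus big_seq; apply: prodr_gt0 => s.
by rewrite mem_irange => st; have /andP[] : 0 < q s < 1 by apply: q01; lia.
Qed.

Lemma xminus_gt0 t : t < u N -> 0 < xminus u q t.
Proof. by move=> tN; rewrite invr_gt0 xplus_gt0. Qed.

(** The step from time [t] to [t + 1] crosses the half-integer encoded by [t]. The prescription at
    [v i] is imposed on the source of the step leaving [v i], so it is counted once. *)
Definition step_ok (t : int) (a c : seq nat) : Prop :=
  [/\ inDminus N u v t -> interlace a c, inDplus N u v t -> interlace c a &
      forall i, (1 <= i <= N)%N -> v i = t -> a = lam i].

(* Summation by parts: [x_t / x_(t-1) = q_t], so the product of these factors
   along a configuration telescopes to its weight. *)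
Definition step (t : int) (a c : seq nat) : R :=
  if `[< step_ok t a c >] then x t ^+ psize a / x t ^+ psize c else 0.

(** Since the intervals between consecutive [u] are disjoint, [t] lies in no other piece: the
    descending and prescription clauses are vacuous. *)
Lemma step_minus i t a c : (1 <= i <= N)%N -> u i.-1 <= t < v i ->
  step t a c = up (xminus u q t) a c.
Proof.
move=> iN ti; have [h1 h2] := uv iN.
have loc j : (1 <= j <= N)%N -> v j <= t < u j -> False.
  move=> jN tj; have [h3 h4] := uv jN.
  have ij : i = j by apply: (@u_locate_uniq _ _ t) => //; lia.
  by subst j; lia.
have x0 : 0 < x t by apply: xplus_gt0; have := v_bounds iN; lia.
rewrite /step /up; have -> : `[< step_ok t a c >] = `[< interlace a c >].
  apply: asbool_equiv_eq; split=> [[+ _ _]|ac]; first by apply; exists i; case/andP: ti.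
  split=> //; first by move=> [j [jN ? ?]]; case: (loc j jN); lia.
  by move=> j jN vj; case: (loc j jN); rewrite -vj lexx; have [] := uv jN.
case: asboolP => // /interlace_psize ac.
by rewrite expf_div ?gt_eqF// ac.
Qed.

Lemma step_plus i t a c : (1 <= i <= N)%N -> v i <= t < u i ->
  step t a c = if (t == v i) && (a != lam i) then 0 else up (x t) c a.
Proof.
move=> iN ti; have [h1 h2] := uv iN.
have loc j : (1 <= j <= N)%N -> u j.-1 <= t < u j -> i = j.
  by move=> jN tj; apply: (@u_locate_uniq _ _ t) => //; lia.
have x0 : 0 < x t by apply: xplus_gt0; have := v_bounds iN; have := @u_mono i N; lia.
rewrite /step /up; case: (boolP (_ && _)) => [/andP[/eqP tv ai]|nai].
  rewrite asboolF// => -[_ _ /(_ i iN (esym tv)) E].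
  by rewrite E eqxx in ai.
have -> : `[< step_ok t a c >] = `[< interlace c a >].
  apply: asbool_equiv_eq; split=> [[_ + _]|ca]; first by apply; exists i; case/andP: ti.
  split=> //.
    move=> [j [jN tj1 tj2]]; have := uv jN => -[h3 h4].
    have ij : i = j by apply: loc => //; lia.
    by subst j; lia.
  move=> j jN vj; have [h3 h4] := uv jN.
  have ij : i = j by apply: loc; lia.
  by move: nai; rewrite -vj ij eqxx negbK => /eqP.
case: asboolP => // /interlace_psize ca; rewrite expf_div ?gt_eqF//.
(* In the remaining branch the sizes agree and both exponents are 0. *)
case: leqP => // ac; have -> : psize a = psize c by apply/eqP; rewrite eqn_leq ac.
by rewrite subnn.
Qed.

(** Under the event, sizes peak at the times [v i], so a common bound for the [lam i] bounds every
    partition that occurs; the sum is such a bound. *)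
Let B := (\sum_(1 <= i < N.+1) psize (lam i))%N.

Lemma lam_box i : (1 <= i <= N)%N -> lam i \in box B.
Proof.
move=> iN; rewrite mem_box lamP//= /B (big_rem i)/= ?leq_addr//.
by rewrite mem_index_iota.
Qed.

Lemma nil_box : [::] \in box B.
Proof. by rewrite mem_box. Qed.

Lemma chain_minus i a b : (1 <= i <= N)%N -> a \in box B -> b \in box B ->
  chain B (map step (irange (u i.-1) (v i))) a b =
  skew_schur (Xminus u v q i) a b.
Proof.
move=> iN aB bB; rewrite (skew_schur_chain _ (box_partition aB) bB) -map_comp.
apply: eq_chain_map => t; rewrite mem_irange => ti c d.
exact: step_minus ti.
Qed.

Lemma chain_plus i a b : (1 <= i <= N)%N -> a \in box B -> b \in box B ->
  chain B (map step (irange (v i) (u i))) a b =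
  (a == lam i)%:R * skew_schur (Xplus u v q i) b a.
Proof.
move=> iN aB bB; have [h1 h2] := uv iN.
rewrite (skew_schur_chain _ (box_partition bB) aB) -chain_down// -map_comp.
(* The first step, at [v i], is the only one carrying the prescription; it exists because
   [v i < u i]. *)
rewrite irange_cons//=; case: (eqVneq a (lam i)) => [aE|ane]; last first.
  rewrite mul0r big1// => c _; rewrite (step_plus _ _ iN); last by lia.
  by rewrite eqxx ane mul0r.
rewrite mul1r; apply: eq_bigr => c _; rewrite (step_plus _ _ iN); last by lia.
rewrite aE !eqxx /=; congr (_ * _); apply: eq_chain_map => t.
rewrite mem_irange => ti d e; rewrite (step_plus _ _ iN); last by lia.
by rewrite ifF//; apply/negbTE; rewrite negb_and; apply/orP; left; lia.
Qed.

Lemma Xplus_ge0 i : (1 <= i <= N)%N -> {in Xplus u v q i, forall y, 0 <= y}.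
Proof.
move=> iN y /mapP[t]; rewrite mem_irange => ti ->.
by apply/ltW/xplus_gt0; have := @u_mono i N; lia.
Qed.

Lemma Xminus_ge0 i : (1 <= i <= N)%N -> {in Xminus u v q i, forall y, 0 <= y}.
Proof.
move=> iN y /mapP[t]; rewrite mem_irange => ti ->.
by apply/ltW/xminus_gt0; have := v_bounds iN; lia.
Qed.

(** A nonzero term needs [c] contained in [a], hence [psize c <= B]: the sum over all partitions is
    finite. *)
Lemma pair_sumE i a b : (1 <= i < N)%N -> a \in box B ->
  pair_sum u v q i a b = \sum_(c <- box B)
    skew_schur (Xplus u v q i) c a * skew_schur (Xminus u v q i.+1) c b.
Proof.
move=> iN aB; rewrite /pair_sum.
set F := fun c => (_ * _)%:E.
have -> : esum [set c | is_partition c] F = esum [set` box B]%classic F.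
  have -> : [set` box B]%classic = ([set c | is_partition c] `&` [set` box B])%classic.
    by apply/seteqP; split=> c /= => [cB|[]//]; split=> //; exact: box_partition cB.
  rewrite esum_mkcondr; apply: eq_esum => c /= cp.
  case: ifPn => //; rewrite notin_setE /= => /negP cB.
  rewrite /F /skew_schur; case: ifPn => [/psubsetP/leq_psize ca|_]; last by rewrite mul0r.
  move: aB cB; rewrite !mem_box cp/= => /andP[_ aB].
  by rewrite (leq_trans ca aB).
rewrite esum_fset; last 2 first.
- exact: finite_seq.
- move=> c _; rewrite lee_fin mulr_ge0// skew_schur_ge0//.
    by apply: Xplus_ge0; lia.
  by apply: Xminus_ge0; lia.
by rewrite -fsbig_seq ?box_uniq//= sumEFin.
Qed.

(** The endpoint [b] at [v n.+1] stays free, since its prescription belongs to the next step.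
    Extending by one descent and one ascent fixes it and produces a [pair_sum], whose summation
    variable is the partition at [u n.+1]. *)
Lemma chain_to_v n b : (n < N)%N -> b \in box B ->
  chain B (map step (irange (u 0) (v n.+1))) [::] b =
  if n is m.+1 then
    skew_schur (Xminus u v q 1) [::] (lam 1%N) *
    \prod_(1 <= i < n) pair_sum u v q i (lam i) (lam i.+1) *
    pair_sum u v q n (lam n) b
  else skew_schur (Xminus u v q 1) [::] b.
Proof.
elim: n b => [|n IH] b nN bB; first by apply: (@chain_minus 1) => //; exact: nil_box.
have iN : (1 <= n.+1 <= N)%N by lia.
have [h1 h2] := uv iN; have [/= h3 h4] := @uv n.+2 nN.
have [h5 _] := v_bounds iN.
rewrite (@irange_cat (u 0) (v n.+1)); [|exact: ltW|by lia].
rewrite (@irange_cat (v n.+1) (u n.+1)); [|exact: ltW|exact: ltW].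
rewrite !map_cat chain_cat ?nil_box//.
under eq_big_seq => c cB.
  rewrite chain_cat//; under eq_big_seq => d dB.
    rewrite chain_plus// (@chain_minus n.+2)// -mulrA.
    over.
  rewrite -big_distrr/= mulrCA; over.
rewrite /=; under eq_bigr do rewrite eq_sym.
rewrite sum_box_delta ?lam_box// -pair_sumE ?lam_box ?iN//.
rewrite IH ?lam_box ?(ltnW nN)//; case: n {IH} nN iN h1 h2 h3 h4 h5 => [|n] *.
  by rewrite big_geq// mulr1.
by rewrite [in RHS]big_nat_recr//= mulrA.
Qed.

Lemma chain_total : (1 <= N)%N ->
  chain B (map step (irange (u 0) (u N))) [::] [::] =
  skew_schur (Xminus u v q 1) [::] (lam 1%N) *
  \prod_(1 <= i < N) pair_sum u v q i (lam i) (lam i.+1) *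
  skew_schur (Xplus u v q N) [::] (lam N).
Proof.
move=> N1; have NN : (1 <= N <= N)%N by rewrite N1 /=.
have [h1 h2] := uv NN; have [h3 h4] := v_bounds NN.
rewrite (@irange_cat (u 0) (v N)); [|exact: ltW|exact: ltW].
rewrite map_cat chain_cat ?nil_box//.
under eq_big_seq => c cB do rewrite chain_plus ?nil_box// mulrCA.
under eq_bigr do rewrite eq_sym.
rewrite sum_box_delta ?lam_box//; congr (_ * _).
have NE : N = N.-1.+1 by rewrite prednK.
rewrite {1}NE chain_to_v ?lam_box// -?NE//; case: (N.-1) NE => [->|n ->].
  by rewrite big_geq// mulr1.
by rewrite [in RHS]big_nat_recr//= mulrA.
Qed.

(** * Configurations as finite paths *)

Local Notation L := (`|u N - u 0%N|%N).
Local Notation event := (fun f : int -> seq nat =>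
  forall i : nat, (1 <= i <= N)%N -> f (v i) = lam i).

(** The entries of [p] sit at the times after [u 0]; the empty partition is put at [u 0] and outside
    the range. *)
Definition path_at (p : seq (seq nat)) (t : int) : seq nat :=
  if u 0%N <= t <= u N then nth [::] ([::] :: p) `|t - u 0%N| else [::].

Lemma u0N : u 0%N <= u N.
Proof. by apply: u_mono; rewrite leq0n leqnn. Qed.

Lemma path_atE p k : (k <= L)%N ->
  path_at p (u 0%N + k%:Z) = nth [::] ([::] :: p) k.
Proof.
move=> kL; rewrite /path_at; have u0N := u0N.
have -> : absz (u 0%N + k%:Z - u 0%N)%R = k by lia.
by rewrite ifT//; lia.
Qed.

(** Between [u i.-1] and [u i] sizes rise up to [v i] and fall afterwards; both halves are
    inductions on the distance to [v i]. *)
Lemma psize_config f t : is_config N u v f -> event f ->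
  (psize (f t) <= B)%N.
Proof.
move=> [fp f0 fm fpl] fE.
case: (boolP (u 0%N <= t < u N)) => [ut|]; last first.
  by rewrite negb_and -!ltNge => h; rewrite f0//; lia.
have [i iN ti] := u_locate (leqnn N) ut; have [h1 h2] := uv iN.
have [h3 h4] := v_bounds iN.
have lB : (psize (f (v i)) <= B)%N.
  by rewrite fE//; have := lam_box iN; rewrite mem_box => /andP[].
apply: leq_trans lB; case: (leP t (v i)) => tv.
  have -> : t = v i - `|v i - t|%N%:Z by lia.
  have : `|v i - t|%N%:Z <= v i - u i.-1 by lia.
  elim: `|v i - t|%N => [|k IH] kv; first by rewrite subr0.
  apply: leq_trans (IH _); last by lia.
  have := fm (v i - k.+1%:Z).
  have -> : v i - k.+1%:Z + 1 = v i - k%:Z by lia.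
  move=> h; apply/interlace_psize/h; first by have := @u_mono 0 i.-1; lia.
  by exists i; split=> //; lia.
have -> : t = v i + `|t - v i|%N%:Z by lia.
have : `|t - v i|%N%:Z <= u i - v i by lia.
elim: `|t - v i|%N => [|k IH] kv; first by rewrite addr0.
apply: leq_trans (IH _); last by lia.
have := fpl (v i + k%:Z).
have -> : v i + k%:Z + 1 = v i + k.+1%:Z by lia.
move=> h; apply/interlace_psize/h; first by have := @u_mono i N; lia.
by exists i; split=> //; lia.
Qed.

Lemma weight_telescope (f : int -> seq nat) : u 0%N < u N -> f (u 0%N) = [::] ->
  f (u N) = [::] ->
  \prod_(k < L) (x (u 0%N + k%:Z) ^+ psize (f (u 0%N + k%:Z)) /
                 x (u 0%N + k%:Z) ^+ psize (f (u 0%N + k%:Z + 1))) =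
  weight N u q f.
Proof.
move=> uN f0 fN.
(* A partial product leaves one pending denominator. The next step cancels it through [xplusS],
   leaving a power of [q]; at the end it is 1 since [f (u N)] is empty. *)
have E n : u 0%N + n%:Z < u N -> \prod_(k < n.+1)
   (x (u 0%N + k%:Z) ^+ psize (f (u 0%N + k%:Z)) /
    x (u 0%N + k%:Z) ^+ psize (f (u 0%N + k%:Z + 1))) =
   (\prod_(t <- irange (u 0%N + 1) (u 0%N + n%:Z + 1)) q t ^+ psize (f t)) /
   x (u 0%N + n%:Z) ^+ psize (f (u 0%N + n%:Z + 1)).
  elim: n => [|n IH] nN.
    by rewrite big_ord1 addr0 f0 expr0 /irange lexx subrr/= big_nil.
  have nN' : u 0%N + n%:Z < u N by lia.
  rewrite big_ord_recr/= IH//.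
  have -> : u 0%N + n.+1%:Z = u 0%N + n%:Z + 1 by lia.
  rewrite (@irangeS _ (u 0%N + n%:Z + 1)); last by lia.
  rewrite -cats1 big_cat/= big_seq1.
  rewrite [in X in _ / _ * (X / _)]xplusS; last by lia.
  rewrite exprMn !mulrA; congr (_ / _); rewrite -!mulrA; congr (_ * _).
  by rewrite mulKf// expf_neq0// gt_eqF// xplus_gt0.
have -> : L = L.-1.+1 by lia.
rewrite E; last by lia.
have -> : u 0%N + L.-1%:Z + 1 = u N by lia.
by rewrite fN expr0 divr1.
Qed.

(** Under the event all sizes are at most [B], so [path_at] identifies the configurations with
    finitely many paths in the box, and the path expansion of the chain applies. *)
Lemma esum_event : (1 <= N)%N ->
  esum [set f | is_config N u v f /\ event f]%classic
    (fun f => (weight N u q f)%:E) =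
  (chain B (map step (irange (u 0%N) (u N))) [::] [::])%:E.
Proof.
move=> N1; have u0N := u0N.
have uN : u 0%N < u N by have [] := @v_bounds N; [rewrite N1 /= | lia].
have sL : size (map step (irange (u 0%N) (u N))) = L.
  by rewrite size_map size_irange.
pose ok p := forall k, (k < L)%N ->
  step_ok (u 0%N + k%:Z) (nth [::] ([::] :: p) k) (nth [::] p k).
pose good p := `[< ok p >] && (last [::] p == [::]).
pose S := [seq p <- box_paths B L | good p].
have SP p : p \in S <-> [/\ p \in box_paths B L, ok p & last [::] p = [::]].
  rewrite mem_filter /good; split=> [/andP[/andP[/asboolP ? /eqP ?]]//|[-> ? ->]].
  by rewrite eqxx !andbT; apply/asboolP.
have pN p : p \in S -> path_at p (u N) = [::].
  move=> /SP[pB _ pl]; have -> : u N = u 0%N + L%:Z by lia.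
  rewrite path_atE//; move: pB; rewrite mem_box_paths => /andP[/eqP <- _].
  by rewrite -last_nth.
have p0 p : path_at p (u 0%N) = [::].
  by rewrite -[X in path_at p X]addr0 (@path_atE p 0).
have pok p : p \in S -> forall t, u 0%N <= t < u N ->
    step_ok t (path_at p t) (path_at p (t + 1)).
  move=> /SP[_ pk _] t tN; have -> : t = u 0%N + `|t - u 0%N|%N%:Z by lia.
  have kL : (`|t - u 0%N| < L)%N by lia.
  have -> : u 0%N + `|t - u 0%N|%N%:Z + 1 = u 0%N + `|t - u 0%N|%N.+1%:Z by lia.
  by rewrite !path_atE ?(ltnW kL)//; exact: pk.
rewrite (@reindex_esum _ _ _ [set` S]%classic _ path_at); last first.
  split.
  - move=> p /= pS; have /SP[pB _ _] := pS; split; last first.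
      (* The value at [v i] is forced by the step leaving [v i], which exists because
         [v i < u N]. *)
      move=> i iN; have [h1 h2] := v_bounds iN.
      by have [|_ _ h] := pok p pS (v i); [lia | exact: h].
    split=> [t|t tN|t tN tm|t tN tp].
    + rewrite /path_at; case: ifP => // _; set k := absz _.
      case: k => [//|k] /=; move: pB; rewrite mem_box_paths => /andP[_ /allP pB].
      case: (ltnP k (size p)) => kp; last by rewrite nth_default.
      by apply: (@box_partition B); apply: pB; exact: mem_nth.
    + case: tN; rewrite le_eqVlt => /predU1P[tE|tu].
      * by rewrite tE p0.
      * by rewrite /path_at ifF//; lia.
      * by rewrite -tE pN.
      * by rewrite /path_at ifF//; lia.
    + by have [h _ _] := pok p pS t tN; exact: h.
    + by have [_ h _] := pok p pS t tN; exact: h.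
  - move=> p p'; rewrite !inE /= => /SP[pB _ _] /SP[pB' _ _] pp'.
    move: pB pB'; rewrite !mem_box_paths => /andP[/eqP sp _] /andP[/eqP sp' _].
    apply: (@eq_from_nth _ [::]); rewrite sp ?sp'// => k kL.
    have := congr1 (fun f => f (u 0%N + k.+1%:Z)) pp'.
    by rewrite !path_atE.
  - move=> f [fc fE]; have [fp f0 fm fpl] := fc.
    pose p := [seq f (u 0%N + k.+1%:Z) | k <- iota 0 L].
    have sp : size p = L by rewrite size_map size_iota.
    have np k : (k <= L)%N -> nth [::] ([::] :: p) k = f (u 0%N + k%:Z).
      case: k => [_|k kL] /=; first by rewrite addr0 f0//; left.
      by rewrite (nth_map 0%N) ?size_iota// nth_iota.
    exists p => /=.
      apply/SP; split.
      * rewrite mem_box_paths sp eqxx/=; apply/allP => c /mapP[k _ ->].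
        by rewrite [mem _ _]mem_box fp/= psize_config.
      * move=> k kL; have := np k.+1 kL => /= ->; rewrite np ?(ltnW kL)//.
        have -> : u 0%N + k.+1%:Z = u 0%N + k%:Z + 1 by lia.
        split=> [h|h|i iN <-]; [apply: fm|apply: fpl|exact: fE] => //; lia.
      * rewrite (last_nth [::]) sp np//; have -> : u 0%N + L%:Z = u N by lia.
        by apply: f0; right.
    apply: funext => t; rewrite /path_at; case: ifPn => [tN|].
      rewrite np; last by lia.
      by congr f; lia.
    by rewrite negb_and -!ltNge => h; rewrite f0//; lia.
have wE p : p \in S -> weight N u q (path_at p) =
    \prod_(k < L) nth (fun _ _ => 0) (map step (irange (u 0%N) (u N))) k
      (nth [::] ([::] :: p) k) (nth [::] p k).
  move=> pS; rewrite -weight_telescope ?pN ?p0//.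
  apply: eq_bigr => k _; rewrite (nth_map 0) ?size_irange// nth_irange//.
  have := pok p pS (u 0%N + k%:Z); have kL := ltn_ord k.
  have -> : u 0%N + k%:Z + 1 = u 0%N + k.+1%:Z by lia.
  rewrite !path_atE ?(ltnW kL)// => h; rewrite /step asboolT//; apply: h; lia.
rewrite esum_fset; last 2 first.
- exact: finite_seq.
- move=> p; rewrite inE /= => pS; rewrite lee_fin -weight_telescope ?pN ?p0//.
  apply: prodr_ge0 => k _; have kL := ltn_ord k.
  by rewrite divr_ge0// exprn_ge0// ltW// xplus_gt0//; lia.
rewrite -fsbig_seq ?filter_uniq ?box_paths_uniq// sumEFin; congr EFin.
rewrite chain_path sL (eq_big_seq _ wE) [LHS]big_filter.
rewrite [LHS]big_mkcond [RHS]big_mkcond; apply: eq_bigr => p _.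
rewrite /good andbC; case: eqP => //= _; case: asboolP => // npok.
(* A path violating some step condition contributes 0, as that factor vanishes. *)
have /existsNP[k /not_implyP[kL nk]] := npok.
rewrite (bigD1 (Ordinal kL))//= (nth_map 0) ?size_irange// nth_irange//.
by rewrite /step asboolF// mul0r.
Qed.

(** * Finiteness of the partition function *)

Lemma size_config f t : is_config N u v f -> u 0%N <= t <= u N ->
  (size (f t) <= L)%N.
Proof.
move=> [fp f0 fm fpl] tN.
suff E k : u 0%N + k%:Z <= u N -> (size (f (u 0%N + k%:Z)%R) <= k)%N.
  have -> : t = u 0%N + `|t - u 0%N|%N%:Z by lia.
  by apply: leq_trans (E _ _) _; lia.
(* An ascending step adds at most one part and a descending step adds none. *)
elim: k => [|k IH] kN; first by rewrite addr0 f0//; left.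
have ut : u 0%N <= u 0%N + k%:Z < u N by lia.
have fk : (size (f (u 0%N + k%:Z)%R) <= k)%N by apply: IH; lia.
have [i iN ti] := u_locate (leqnn N) ut.
have := fm _ ut; have := fpl _ ut.
have -> : u 0%N + k%:Z + 1 = u 0%N + k.+1%:Z by lia.
move=> hpl hm; case: (ltP (u 0%N + k%:Z) (v i)) => tv.
  have h : interlace (f (u 0%N + k%:Z)) (f (u 0%N + k.+1%:Z)).
    by apply: hm; exists i; case/andP: ti.
  have /andP[_ le1] := interlace_size (fp _) (fp _) h.
  by rewrite (leq_trans le1)// ltnS.
have h : interlace (f (u 0%N + k.+1%:Z)) (f (u 0%N + k%:Z)).
  by apply: hpl; exists i; case/andP: ti.
have /andP[le1 _] := interlace_size (fp _) (fp _) h.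
by rewrite (leq_trans le1)// (leq_trans fk).
Qed.

(* A configuration is determined by the matrix of its first [L] parts at the
   interior times, so [Z] is at most a product of geometric series. *)
Lemma Zpart_lty : (Zpart N u v q < +oo)%E.
Proof.
pose r := irange (u 0%N + 1) (u N).
pose bound := \prod_(kj : 'I_(size r) * 'I_L) (1 - q r`_kj.1)^-1.
have rq k : (k < size r)%N -> 0 < q r`_k < 1.
  move=> kr; have := mem_nth 0 kr; move: (r`_k) => t.
  by rewrite mem_irange => tr; apply: q01; lia.
suff : (Zpart N u v q <= bound%:E)%E by move=> /le_lt_trans; apply; rewrite ltry.
(* The sum is a supremum over finite sets of configurations, so each finite partial sum is
   bounded. *)
apply: ge_ereal_sup => _ [A [Afin Ac] <-].
have [s0 As0] := iffLR (finite_seqP _) Afin.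
pose s : seq (int -> seq nat) := undup s0.
have As : A = [set` s]%classic.
  by rewrite As0; apply/seteqP; split=> f /=; rewrite mem_undup.
rewrite As -fsbig_seq ?undup_uniq//= sumEFin lee_fin.
have sc f : f \in s -> is_config N u v f by move=> fs; apply: Ac; rewrite As.
have rb t : t \in r -> u 0%N <= t <= u N by rewrite mem_irange; lia.
(* A bound for all parts in this finite set; it makes the type of matrices finite, while [bound]
   does not depend on it. *)
pose K := (\sum_(f <- s) \sum_(t <- r) psize (f t))%N.
have partK f t j : f \in s -> t \in r -> (part (f t) j <= K)%N.
  move=> fs tr; rewrite /K (big_rem f)//= (big_rem t)//= -addnA.
  exact: leq_trans (part_le_psize _ _) (leq_addr _ _).
pose G (kj : 'I_(size r) * 'I_L) (e : 'I_K.+1) : R := q r`_kj.1 ^+ e.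
pose m (f : int -> seq nat) : {ffun 'I_(size r) * 'I_L -> 'I_K.+1} :=
  [ffun kj : 'I_(size r) * 'I_L => inord (part (f r`_kj.1) kj.2)].
have mE f (kj : 'I_(size r) * 'I_L) : f \in s -> m f kj = part (f r`_kj.1) kj.2 :> nat.
  by move=> fs; rewrite ffunE inordK// ltnS partK// mem_nth.
have wE f : f \in s -> weight N u q f = \prod_kj G kj (m f kj).
  move=> fs; rewrite /weight (big_nth 0) big_mkord.
  transitivity (\prod_k \prod_j G (k, j) (m f (k, j))); last first.
    by rewrite pair_bigA; apply: eq_bigr => -[].
  apply: eq_bigr => k _; rewrite (@psizeE _ L); last first.
    by apply: size_config (sc _ fs) _; apply: rb; exact: mem_nth.
  by rewrite expr_sum; apply: eq_bigr => j _; rewrite /G mE.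
have m_inj : {in s &, injective m}.
  move=> f g fs gs fg; apply: funext => t.
  have [fp f0 _ _] := sc f fs; have [gp g0 _ _] := sc g gs.
  case: (boolP (t \in r)) => [tr|]; last first.
    rewrite mem_irange => tr; have h : t <= u 0%N \/ u N <= t by lia.
    by rewrite f0 ?g0.
  apply: partition_ext => // j; have := tr; rewrite -index_mem => tk.
  case: (ltnP j L) => jL; last first.
    by rewrite !part_default//; (apply: leq_trans jL; apply: size_config (rb _ tr); exact: sc).
  have := congr1 (fun h : {ffun _ -> 'I_K.+1} => h (Ordinal tk, Ordinal jL) : nat) fg.
  by rewrite /= !mE//= nth_index.
have G0 kj e : 0 <= G kj e.
  by rewrite exprn_ge0// ltW//; have /andP[] := rq _ (ltn_ord kj.1).
rewrite (eq_big_seq _ wE) -(big_map m xpredT (fun g => \prod_kj G kj (g kj))).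
rewrite big_uniq/= ?map_inj_in_uniq ?undup_uniq//.
(* Enlarging the sum to all matrices with entries at most [K] lets it factor into one geometric sum
   per matrix position. *)
apply: (@le_trans _ _ (\sum_(g : {ffun _ -> _}) \prod_kj G kj (g kj))).
  rewrite [leRHS](bigID (mem (map m s)))/= lerDl.
  by apply: sumr_ge0 => g _; apply: prodr_ge0.
rewrite -bigA_distr_bigA; apply: ler_prod => kj _.
by rewrite sumr_ge0//= /G geometric_sum_le// rq.
Qed.

End JointLaw.

Theorem mainTheorem1 (R : realType) (N : nat) (u v : nat -> int) (q : int -> R)
  (lam : nat -> seq nat) :
  (1 <= N)%N ->
  (forall i : nat, (1 <= i <= N)%N -> u i.-1 < v i /\ v i < u i) ->
  (forall t : int, u 0%N < t < u N -> 0 < q t < 1) ->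
  (forall i : nat, (1 <= i <= N)%N -> is_partition (lam i)) ->
  (Zpart N u v q < +oo)%E /\
  Prob N u v q (fun f => forall i : nat, (1 <= i <= N)%N -> f (v i) = lam i) =
    (fine (Zpart N u v q))^-1 *
    (skew_schur (Xminus u v q 1) [::] (lam 1%N) *
     \prod_(1 <= i < N) pair_sum u v q i (lam i) (lam i.+1) *
     skew_schur (Xplus u v q N) [::] (lam N)).
Proof.
move=> N1 uv q01 lamP; split; first exact: Zpart_lty.
by rewrite /Prob (esum_event uv q01 lamP N1) (chain_total uv q01 lamP N1) mulrC.
Qed.
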